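(* Let $Q=\mathbb{R}^n\times S^{n-1}$, $n\ge2$. The bicycle correspondence $\Phi:Q\to Q$, $\Phi(\mathbf{x},\mathbf{v})=(\mathbf{x}-2\mathbf{v},-\mathbf{v})$, is a sub-Riemannian isometry, i.e., it preserves the distribution $\mathscr{D}\subset TQ$ and the sub-Riemannian metric on it.
   Context: $Q=\{(\mathbf{x},\mathbf{v})\in\mathbb{R}^n\times\mathbb{R}^n:|\mathbf{v}|=1\}$. $\mathscr{D}\subset TQ$ is the rank $n$ distribution consisting of the vectors $(\mathbf{x}',\mathbf{v}')\in T_{(\mathbf{x},\mathbf{v})}Q$ with $\mathbf{v}'=\mathbf{x}'-(\mathbf{x}'\cdot\mathbf{v})\mathbf{v}$ (the no-skid condition for bicycle paths with front track $\mathbf{x}$, back track $\mathbf{x}-\mathbf{v}$). The sub-Riemannian metric on $\mathscr{D}$ is the one for which the length of $(\mathbf{x}',\mathbf{v}')\in\mathscr{D}$ is the Euclidean length $|\mathbf{x}'|$. *)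

(* Defs.v *)
From mathcomp Require Import all_boot all_order all_algebra.
From mathcomp Require Import all_classical all_reals all_analysis.

Set Implicit Arguments.
Unset Strict Implicit.
Unset Printing Implicit Defensive.

Import Order.TTheory GRing.Theory Num.Theory numFieldNormedType.Exports.

Local Open Scope classical_set_scope.
Local Open Scope ring_scope.

Section Smooth.
Variables (R : realType) (V W : normedModType R).

Fixpoint Ck (k : nat) (f : V -> W) : Prop :=
  match k with
  | 0 => continuous f
  | k'.+1 => (forall x, differentiable f x) /\
             (forall v, Ck k' (fun x => 'd f x v))
  end.

(* For finite-dimensional V (the only case used) this is the usual C^oo. *)
Definition smooth (f : V -> W) : Prop := forall k, Ck k f.

End Smooth.

(* A closed submanifold is given as a subset M of a normed space V, and a
   smooth map of M as the restriction to M of a smooth map V -> V. *)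
Section SubRiemannian.
Variables (R : realType) (V : normedModType R).

Definition tangent_space (M : set V) (q : V) : set V :=
  [set w | exists c : R -> V,
     [/\ smooth c, forall t, M (c t), c 0 = q & 'd c (0 : R) (1 : R) = w]].

Definition diffeo_on (M : set V) (f : V -> V) : Prop :=
  [/\ smooth f, set_fun M M f &
      exists g : V -> V,
        [/\ smooth g, set_fun M M g,
            forall q, M q -> g (f q) = q & forall q, M q -> f (g q) = q]].

(* The differential at q of the restriction of f to M is the restriction of
   'd f q to the tangent space at q, which contains D q. *)
Definition preserves_distribution (M : set V) (D : V -> set V) (f : V -> V) :=
  forall q, M q -> 'd f q @` D q = D (f q).

(* g q is the inner product on D q; only its values on D q are meaningful. *)
Definition preserves_metric (M : set V) (D : V -> set V) (g : V -> V -> V -> R)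
    (f : V -> V) :=
  forall q, M q -> forall w1 w2, D q w1 -> D q w2 ->
    g (f q) ('d f q w1) ('d f q w2) = g q w1 w2.

Definition subRiemannian_isometry (M : set V) (D : V -> set V)
    (g : V -> V -> V -> R) (f : V -> V) : Prop :=
  [/\ diffeo_on M f, preserves_distribution M D f & preserves_metric M D g f].

End SubRiemannian.

Section Bicycle.
Variables (R : realType) (n : nat).

Local Notation E := ('rV[R]_n * 'rV[R]_n)%type.

(* The library norm `|u| on row vectors is the sup norm, hence these. *)
Definition dotp (u v : 'rV[R]_n) : R := \sum_(i < n) u 0 i * v 0 i.

Definition enorm (u : 'rV[R]_n) : R := Num.sqrt (dotp u u).

Definition bike_Q : set E := [set q | enorm q.2 = 1].

Definition bike_D (q : E) : set E :=
  [set w | tangent_space bike_Q q w /\ w.2 = w.1 - dotp w.1 q.2 *: q.2].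

(* The inner product whose length Num.sqrt (bike_metric q w w) is, by
   definition, the Euclidean length enorm w.1. *)
Definition bike_metric (q w1 w2 : E) : R := dotp w1.1 w2.1.

Definition bike_Phi (q : E) : E := (q.1 - 2 *: q.2, - q.2).

End Bicycle.

(* Main.v *)
Require Import Defs.
From HB Require Import structures.
From mathcomp Require Import all_boot all_order all_algebra.
From mathcomp Require Import all_classical all_reals all_analysis.
From mathcomp Require Import ring.

(** The bicycle correspondence is the restriction of a linear involution of
    the ambient space [R^n x R^n], so it is smooth, it is its own inverse and
    it is its own differential at every point ([diff_continuous_linear]).  It
    maps [Q] to itself because the second component only changes sign, and
    hence it carries curves in [Q] to curves in [Q], and tangent vectors to
    tangent vectors ([tangent_space_linear]).

    On the distribution, with [q = (x, v)] and [|v| = 1], a vector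
    [w = (x', v')] is sent to [(x' - 2 v', - v')], and the no-skid condition
    [v' = x' - (x' . v) v] turns the first component into
    [2 (x' . v) v - x'], the reflection of [x'] in the line spanned by [v].
    Reflections are orthogonal, which gives the metric statement
    ([dotp_line_reflection]); the reflection leaves [x' . v] unchanged, which
    gives the no-skid condition at the image point.  So the differential maps
    the distribution at [q] into the distribution at the image of [q]; applied
    at the image point, the involution turns this inclusion into an
    equality. *)

Set Implicit Arguments.
Unset Strict Implicit.
Unset Printing Implicit Defensive.

Import Order.TTheory GRing.Theory Num.Theory numFieldNormedType.Exports.

Local Open Scope classical_set_scope.
Local Open Scope ring_scope.

Section LinearSmooth.
Variables (R : realType) (U V W : normedModType R).

Lemma Ck_cst (k : nat) (a : W) : Ck k (fun _ : V => a).
Proof.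
elim: k a => [|k IHk] a /=; first by move=> x; exact: cvg_cst.
split=> [x|v]; first exact: differentiable_cst.
have -> : (fun x : V => 'd (fun _ : V => a) x v) = (fun _ => 0).
  by apply/funext => x; rewrite (diff_cst a x).
exact: IHk.
Qed.

Lemma diff_continuous_linear (f : {linear V -> W}) (x : V) :
  continuous f -> 'd f x = f :> (V -> W).
Proof. by move=> fc; exact: diff_lin. Qed.

Lemma smooth_linear (f : {linear V -> W}) : continuous f -> smooth f.
Proof.
move=> fc [|k] //=; split=> [x|v]; first exact: linear_differentiable.
have -> : (fun x : V => 'd f x v) = (fun _ => f v).
  by apply/funext => x; rewrite diff_continuous_linear.
exact: Ck_cst.
Qed.

Lemma diff_linear_comp (f : {linear V -> W}) (c : U -> V) (x : U) :
  continuous f -> differentiable c x -> 'd (f \o c) x = f \o 'd c x :> (U -> W).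
Proof.
move=> fc cx; rewrite diff_comp //; last exact: linear_differentiable.
by rewrite diff_continuous_linear.
Qed.

(** The induction on the order of differentiability goes through because the
    directional derivative of [f \o c] is again of the form [f \o c'], with
    [c'] the directional derivative of [c]. *)
Lemma smooth_linear_comp (f : {linear V -> W}) (c : U -> V) :
  continuous f -> smooth c -> smooth (f \o c).
Proof.
move=> fc sc k; elim: k c {sc}(sc k) => [|k IHk] c /=.
  by move=> cc x; apply: continuous_comp; [exact: cc | exact: fc].
case=> dc Ckdc; split=> [x|v].
  by apply: differentiable_comp => //; exact: linear_differentiable.
have -> : (fun x => 'd (f \o c) x v) = f \o (fun x => 'd c x v).
  by apply/funext => x; rewrite diff_linear_comp.
by apply: IHk; exact: Ckdc.
Qed.

End LinearSmooth.

(** The curve that represents [w] is pushed forward by [f], and [f] is its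
    own differential. *)
Lemma tangent_space_linear (R : realType) (V : normedModType R) (M : set V)
    (f : {linear V -> V}) (q w : V) :
  continuous f -> set_fun M M f ->
  tangent_space M q w -> tangent_space M (f q) (f w).
Proof.
move=> fc fM [c [sc cM c0 dc]]; exists (f \o c); split.
- exact: smooth_linear_comp.
- by move=> t; exact/fM/cM.
- by rewrite /= c0.
- have [dc0 _] := sc 1.
  by rewrite diff_linear_comp //= dc.
Qed.

Section DotProduct.
Variables (R : realType) (n : nat).
Implicit Types u v w : 'rV[R]_n.

Lemma dotpC u v : dotp u v = dotp v u.
Proof. by apply: eq_bigr => i _; rewrite mulrC. Qed.

Lemma dotpDl u v w : dotp (u + v) w = dotp u w + dotp v w.
Proof. by rewrite -big_split; apply: eq_bigr => i _; rewrite mxE mulrDl. Qed.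

Lemma dotpZl (a : R) u v : dotp (a *: u) v = a * dotp u v.
Proof. by rewrite /dotp mulr_sumr; apply: eq_bigr => i _; rewrite mxE mulrA. Qed.

Lemma dotpNl u v : dotp (- u) v = - dotp u v.
Proof. by rewrite -scaleN1r dotpZl mulN1r. Qed.

Lemma dotpDr u v w : dotp u (v + w) = dotp u v + dotp u w.
Proof. by rewrite !(dotpC u) dotpDl. Qed.

Lemma dotpZr (a : R) u v : dotp u (a *: v) = a * dotp u v.
Proof. by rewrite !(dotpC u) dotpZl. Qed.

Lemma dotpNr u v : dotp u (- v) = - dotp u v.
Proof. by rewrite !(dotpC u) dotpNl. Qed.

Lemma enorm1_dotp v : enorm v = 1 -> dotp v v = 1.
Proof.
move=> v1; rewrite -[LHS]sqr_sqrtr -/(enorm v) ?v1 ?expr1n //.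
by apply: sumr_ge0 => i _; rewrite -expr2 sqr_ge0.
Qed.

(** The orthogonal reflection in the line spanned by [v], for [v] of Euclidean
    norm [1] only: there is no division by [dotp v v]. *)
Definition line_reflection v u := (2 * dotp u v) *: v - u.

Lemma dotp_line_reflection v u w : dotp v v = 1 ->
  dotp (line_reflection v u) (line_reflection v w) = dotp u w.
Proof.
move=> v1; rewrite /line_reflection.
rewrite !(dotpDl, dotpDr, dotpZl, dotpZr, dotpNl, dotpNr) v1 (dotpC v w).
by ring.
Qed.

Lemma dotp_line_reflection_axis v u : dotp v v = 1 ->
  dotp (line_reflection v u) v = dotp u v.
Proof.
by move=> v1; rewrite /line_reflection dotpDl dotpZl dotpNl v1; ring.
Qed.

End DotProduct.

Section BicycleCorrespondence.
Variables (R : realType) (n : nat).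
Local Notation E := ('rV[R]_n * 'rV[R]_n)%type.
Local Notation Phi := (@bike_Phi R n).

Lemma bike_Phi_is_linear : linear Phi.
Proof.
move=> a [x v] [y w]; rewrite /bike_Phi /=; congr pair => /=.
  by rewrite scalerBr scalerDr !scalerA mulrC opprD addrACA.
by rewrite opprD scalerN.
Qed.

HB.instance Definition _ := GRing.isLinear.Build R E E _ Phi bike_Phi_is_linear.

Lemma bike_Phi_continuous : continuous Phi.
Proof.
move=> q; have q1 : (fun p : E => p.1) @ q --> q.1 by exact: cvg_fst.
have q2 : (fun p : E => p.2) @ q --> q.2 by exact: cvg_snd.
(* The neighborhoods of a pair are the product filter; both factors have to
   be given for the componentwise limits to be recognized. *)
apply: (@cvg_pair _ _ _ _ (nbhs (q.1 - 2 *: q.2)) (nbhs (- q.2))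
  _ _ _ (fun p : E => p.1 - 2 *: p.2) (fun p : E => - p.2)); last exact: cvgN.
by apply: cvgB => //; apply: cvgZr.
Qed.

Lemma bike_PhiK : involutive Phi.
Proof.
case=> x v; rewrite /bike_Phi /=; congr pair; last by rewrite opprK.
by rewrite scalerN opprK subrK.
Qed.

Lemma bike_Phi_Q : set_fun (@bike_Q R n) (@bike_Q R n) Phi.
Proof.
by move=> q; rewrite /bike_Q /= /enorm dotpNl dotpNr opprK.
Qed.

(** The no-skid condition makes the correspondence act on the front-track
    velocity of a vector of the distribution as a reflection. *)
Lemma bike_Phi_fst (q w : E) : bike_D q w ->
  (Phi w).1 = line_reflection q.2 w.1.
Proof.
case=> _ w2; rewrite /bike_Phi /line_reflection /= w2 scalerBr scalerA.
by rewrite opprB addrCA scaler_nat mulr2n opprD addNKr.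
Qed.

Lemma bike_Phi_D (q w : E) : bike_Q q -> bike_D q w -> bike_D (Phi q) (Phi w).
Proof.
move=> Qq Dw; split.
  case: Dw => Tw _; apply: tangent_space_linear Tw.
    exact: bike_Phi_continuous.
  exact: bike_Phi_Q.
rewrite (bike_Phi_fst Dw) [(Phi q).2]/= dotpNr scalerN scaleNr opprK.
rewrite dotp_line_reflection_axis; last exact: enorm1_dotp.
case: Dw => _; rewrite /line_reflection /= => ->.
by rewrite mulrDl mul1r scalerDl opprB addrAC addrK.
Qed.

End BicycleCorrespondence.

Theorem lemma3p13 (R : realType) (n : nat) (hn : (2 <= n)%N) :
  subRiemannian_isometry (@bike_Q R n) (@bike_D R n) (@bike_metric R n)
    (@bike_Phi R n).
Proof.
have smoothPhi : smooth (@bike_Phi R n).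
  by apply: smooth_linear; exact: bike_Phi_continuous.
have dPhi q : 'd (@bike_Phi R n) q = @bike_Phi R n :> (_ -> _).
  by apply: diff_continuous_linear; exact: bike_Phi_continuous.
split.
- split=> //; first exact: bike_Phi_Q.
  exists (@bike_Phi R n); split=> //; first exact: bike_Phi_Q.
    by move=> q _; exact: bike_PhiK.
  by move=> q _; exact: bike_PhiK.
- move=> q Qq; rewrite dPhi; apply/seteqP; split=> [_ [w Dw <-]|w Dw].
    exact: bike_Phi_D.
  (* The preimage of [w] is its image, by the inclusion at [bike_Phi q]. *)
  exists (bike_Phi w); last exact: bike_PhiK.
  by rewrite -[q]bike_PhiK; apply: bike_Phi_D => //; exact: bike_Phi_Q.
- move=> q Qq w1 w2 Dw1 Dw2; rewrite /bike_metric dPhi.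
  rewrite (bike_Phi_fst Dw1) (bike_Phi_fst Dw2).
  by rewrite dotp_line_reflection //; exact: enorm1_dotp.
Qed.
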